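(* For every Banach space $X$, every $p\in[1,\infty]$ and every $n\in\mathbb{N}$, $$\mathfrak{P}_p^n(X)\le\sum_{k=1}^n\frac1k .$$
   Context: Let $(X,\|\cdot\|)$ be a Banach space, $n\in\mathbb N$, and let $\mu$ be the uniform probability measure on $\{-1,1\}^n$. For $f:\{-1,1\}^n\to X$ and $j\in\{1,\ldots,n\}$, the hypercube partial derivative is $\partial_jf(\varepsilon)=\frac{f(\varepsilon)-f(\varepsilon_1,\ldots,\varepsilon_{j-1},-\varepsilon_j,\varepsilon_{j+1},\ldots,\varepsilon_n)}{2}$, and the hypercube Laplacian is $\Delta f=\sum_{j=1}^n\partial_jf$. The $n$-dimensional Pisier constant of $X$ with exponent $p$, denoted $\mathfrak P_p^n(X)$, is the infimum over those $\mathfrak P\in(0,\infty)$ such that every $f_1,\ldots,f_n:\{-1,1\}^n\to X$ satisfy $$\Bigg(\int_{\{-1,1\}^n}\Big\|\sum_{j=1}^n\partial_jf_j(\varepsilon)\Big\|^pd\mu(\varepsilon)\Bigg)^{1/p}\le\mathfrak P\Bigg(\int_{\{-1,1\}^n}\int_{\{-1,1\}^n}\Big\|\sum_{j=1}^n\delta_j\Delta f_j(\varepsilon)\Big\|^pd\mu(\varepsilon)d\mu(\delta)\Bigg)^{1/p},$$ with the usual interpretation as maxima when $p=\infty$. *)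

(* Defs.v *)
From HB Require Import structures.
From mathcomp Require Import all_boot all_order all_algebra.
From mathcomp Require Import all_classical all_reals all_analysis.

Set Implicit Arguments.
Unset Strict Implicit.
Unset Printing Implicit Defensive.

Import Order.TTheory GRing.Theory Num.Theory.
Import numFieldNormedType.Exports.

Local Open Scope classical_set_scope.
Local Open Scope ring_scope.

(* The hypercube {-1,1}^n: the boolean coordinate b encodes the sign (-1)^b. *)
Notation cube n := {ffun 'I_n -> bool}.

Definition signc (R : realType) (n : nat) (e : cube n) (j : 'I_n) : R :=
  (-1) ^+ e j.

Definition flip (n : nat) (j : 'I_n) (e : cube n) : cube n :=
  [ffun i => if i == j then ~~ e i else e i].

(* Integral against the uniform probability measure on {-1,1}^n. *)
Definition mean (R : realType) (n : nat) (g : cube n -> R) : R :=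
  (2 ^+ n)^-1 * \sum_(e : cube n) g e.

Definition partial (R : realType) (X : normedModType R) (n : nat) (j : 'I_n)
    (f : cube n -> X) (e : cube n) : X :=
  2^-1 *: (f e - f (flip j e)).

Definition laplacian (R : realType) (X : normedModType R) (n : nat)
    (f : cube n -> X) (e : cube n) : X :=
  \sum_(j < n) partial j f e.

(* The value at p = -oo in the next two definitions is never used: only
   1 <= p is meaningful. The maxima for p = +oo are of nonnegative numbers over
   a nonempty type, so starting them at 0 is harmless. *)
Definition lpnorm (R : realType) (X : normedModType R) (n : nat)
    (p : \bar R) (F : cube n -> X) : R :=
  match p with
  | r%:E => mean (fun e => `|F e| `^ r) `^ r^-1
  | +oo%E => \big[Num.max/0]_(e : cube n) `|F e|
  | -oo%E => 0
  end.

Definition lpnorm2 (R : realType) (X : normedModType R) (n : nat)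
    (p : \bar R) (F : cube n -> cube n -> X) : R :=
  match p with
  | r%:E => mean (fun d => mean (fun e => `|F e d| `^ r)) `^ r^-1
  | +oo%E => \big[Num.max/0]_(d : cube n) \big[Num.max/0]_(e : cube n) `|F e d|
  | -oo%E => 0
  end.

Definition pisier_ineq (R : realType) (X : normedModType R) (p : \bar R)
    (n : nat) (P : R) : Prop :=
  forall f : 'I_n -> cube n -> X,
    lpnorm p (fun e => \sum_(j < n) partial j (f j) e) <=
    P * lpnorm2 p (fun e d => \sum_(j < n) signc R d j *: laplacian (f j) e).

(* Valued in \bar R so that the infimum of the empty set is +oo. *)
Definition pisier_constant (R : realType) (X : normedModType R) (p : \bar R)
    (n : nat) : \bar R :=
  ereal_inf [set P%:E | P in [set P : R | 0 < P /\ pisier_ineq X p n P]].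

(* Main.v *)
(* For a set S of coordinates let e * d_S be e multiplied by d on S only. Then
     sum_j partial_j f_j (e)
       = sum_S w_|S| E_d [sum_j d_j (laplacian f_j) (e * d_S)],
   with w_k = 1 / (k 'C(n, k)) for k >= 1; these weights sum to the n-th harmonic
   number. For fixed j, put a_S = E_d [d_j f (e * d_S)]; it vanishes if j is not
   in S, it is partial_j f (e) if S = {j}, and averaging over one more coordinate
   i gives, for j in S,
     E_d [d_j (laplacian f) (e * d_S)]
       = (n - |S| + 1) a_S - sum_(i notin S) a_(S + i),
   so the weighted sum over S telescopes to the single term a_{j}.
   As (e, d) |-> (e * d_S, d) preserves the uniform measure, each term has the
   L_p norm of the right-hand side of Pisier's inequality at most, and convexity
   of the norm concludes. The weights are the Beta integrals obtained by
   expanding the kernel of the heat-semigroup formula for the inverse of the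
   Laplacian. *)

Require Import Defs.
From HB Require Import structures.
From mathcomp Require Import all_boot all_order all_algebra.
From mathcomp Require Import all_classical all_reals all_analysis.
From mathcomp Require Import ring.

Set Implicit Arguments.
Unset Strict Implicit.
Unset Printing Implicit Defensive.

Import Order.TTheory GRing.Theory Num.Theory.
Import numFieldNormedType.Exports.

Local Open Scope classical_set_scope.
Local Open Scope ring_scope.

(** * Sign changes on the cube *)

Section Cube.
Context (n : nat).
Implicit Types (S : {set 'I_n}) (d e : cube n).

Lemma flipK (i : 'I_n) : involutive (@flip n i).
Proof. by move=> e; apply/ffunP => k; rewrite !ffunE; case: eqP => //; rewrite negbK. Qed.

(** Signs are stored as booleans, so [(+)] multiplies them: this is the point e * d_S. *)
Definition twist S d e : cube n := [ffun i => e i (+) ((i \in S) && d i)].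

Lemma twistK S d : involutive (twist S d).
Proof. by move=> e; apply/ffunP => k; rewrite !ffunE addbK. Qed.

Lemma twist_flip_in S d e i : i \in S ->
  twist S (flip i d) e = flip i (twist S d e).
Proof.
move=> iS; apply/ffunP => k; rewrite !ffunE.
by case: eqP => // ->; rewrite iS /= addbN.
Qed.

Lemma twist_flip_notin S d e i : i \notin S -> twist S (flip i d) e = twist S d e.
Proof.
move=> iS; apply/ffunP => k; rewrite !ffunE.
by case: eqP => // ->; rewrite (negbTE iS).
Qed.

Lemma twist_setU1 S d e i : i \notin S ->
  twist (i |: S) d e = if d i then flip i (twist S d e) else twist S d e.
Proof.
move=> iS; apply/ffunP => k; rewrite !ffunE !inE.
case: eqP => [->|/eqP ki]; case di: (d i); rewrite !ffunE /= ?eqxx ?(negbTE iS) ?(negbTE ki) //=.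
  by rewrite addbT addbF.
Qed.

Lemma twist0 d e : twist finset.set0 d e = e.
Proof. by apply/ffunP => k; rewrite !ffunE !inE addbF. Qed.

End Cube.

Lemma signc_flip (R : realType) n (d : cube n) (i j : 'I_n) :
  signc R (flip i d) j = if j == i then - signc R d j else signc R d j.
Proof. by rewrite /signc ffunE; case: eqP => // _; rewrite signrN. Qed.

(** * Signed averages over the twisting vector *)

Section SignedAverage.
Context (R : realType) (X : normedModType R) (n : nat).
Implicit Types (S : {set 'I_n}) (h f : cube n -> X) (d e : cube n) (i j : 'I_n).

Definition savg S j h e : X :=
  (2 ^+ n)^-1 *: \sum_(d : cube n) signc R d j *: h (twist S d e).

Lemma savg_sum (I : finType) S j (h : I -> cube n -> X) e :
  savg S j (fun e => \sum_i h i e) e = \sum_i savg S j (h i) e.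
Proof.
rewrite /savg -[RHS]scaler_sumr [in RHS]exchange_big /=; congr (_ *: _).
by apply: eq_bigr => d _; rewrite scaler_sumr.
Qed.

Lemma savg_partial S j i f e :
  savg S j (partial i f) e = 2^-1 *: (savg S j f e - savg S j (f \o flip i) e).
Proof.
rewrite /savg -scalerBr -sumrB scalerA mulrC -scalerA
  [2^-1 *: \sum_(_ | _) _]scaler_sumr; congr (_ *: _).
by apply: eq_bigr => d _; rewrite -scalerBr !scalerA mulrC.
Qed.

(** Replacing [d] by [flip j d] fixes the twisted point and reverses the sign, so the sum is its own
    opposite. *)
Lemma savg_notin S j h e : j \notin S -> savg S j h e = 0.
Proof.
move=> jS; rewrite /savg; set s := \sum_d _.
have sN : s = - s.
  rewrite {1}/s (reindex_inj (inv_inj (flipK j))) -sumrN; apply: eq_bigr => d _.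
  by rewrite signc_flip eqxx twist_flip_notin // scaleNr.
have : 2 *: s = 0 by rewrite scaler_nat mulr2n {1}sN addNr.
by move/eqP; rewrite scaler_eq0 pnatr_eq0 /= => /eqP ->; rewrite scaler0.
Qed.

(** The change of variable [d] to [flip i d] absorbs the flip; it costs a sign only through the
    factor d_j. *)
Lemma savg_flip_in S j i h e : i \in S ->
  savg S j (h \o flip i) e = if j == i then - savg S j h e else savg S j h e.
Proof.
move=> iS; have -> : savg S j (h \o flip i) e = (2 ^+ n)^-1 *:
    \sum_d (if j == i then - signc R d j else signc R d j) *: h (twist S d e).
  rewrite /savg (reindex_inj (inv_inj (flipK i))); congr (_ *: _).
  by apply: eq_bigr => d _; rewrite signc_flip /= twist_flip_in // flipK.
case: ifP => // _; rewrite /savg -scalerN -sumrN; congr (_ *: _).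
by apply: eq_bigr => d _; rewrite scaleNr.
Qed.

(** Pairing [d] with [flip i d], exactly one of the two flips coordinate [i] of the argument, and
    both carry the same sign d_j. *)
Lemma savg_setU1 S j i h e : i \notin S -> j != i ->
  savg (i |: S) j h e = 2^-1 *: (savg S j h e + savg S j (h \o flip i) e).
Proof.
move=> iS ji; apply: (scalerI (_ : 2 != 0 :> R)); first by rewrite pnatr_eq0.
rewrite [RHS]scalerA mulfV ?pnatr_eq0 // scale1r scaler_nat mulr2n /savg.
rewrite -!scalerDr; congr (_ *: _).
rewrite {2}(reindex_inj (inv_inj (flipK i))) -!big_split; apply: eq_bigr => d _ /=.
rewrite signc_flip (negbTE ji) !twist_setU1 // twist_flip_notin // ffunE eqxx.
by case: (d i) => //=; rewrite addrC.
Qed.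

Lemma savg_set1 j h e : savg [set j] j h e = partial j h e.
Proof.
apply: (scalerI (_ : 2 != 0 :> R)); first by rewrite pnatr_eq0.
rewrite /partial [RHS]scalerA mulfV ?pnatr_eq0 // scale1r scaler_nat mulr2n /savg.
rewrite -!scalerDr {2}(reindex_inj (inv_inj (flipK j))) -big_split /=.
rewrite (eq_bigr (fun=> h e - h (flip j e))) => [|d _].
  rewrite sumr_const card_ffun card_bool card_ord -[X in _ *: X]scaler_nat scalerA natrX.
  by rewrite mulVf ?expf_neq0 ?pnatr_eq0 // scale1r.
rewrite signc_flip eqxx -(finset.setU0 [set j]) !twist_setU1 ?inE // !twist0 ffunE eqxx.
rewrite /signc; case: (d j) => /=; rewrite ?expr1 ?expr0 ?scaleN1r ?scale1r ?opprK ?scale1r //.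
by rewrite addrC.
Qed.

(** Write a_S for [savg S j f e]. The derivative in direction [i] contributes 0 if [i] is in [S] and
    differs from [j], a_S if [i] is [j], and a_S - a_(S + i) if [i] is outside [S]. *)
Lemma savg_laplacian S j f e : j \in S ->
  savg S j (laplacian f) e =
  (n - #|S|).+1%:R *: savg S j f e - \sum_(i | i \notin S) savg (i |: S) j f e.
Proof.
move=> jS; rewrite savg_sum (bigID (mem S)) /= (bigD1 j) //= big1 ?addr0; last first.
  move=> i /andP[iS ij]; rewrite savg_partial savg_flip_in //.
  by rewrite eq_sym (negbTE ij) subrr scaler0.
have half (x : X) : 2^-1 *: (x + x) = x.
  by rewrite -mulr2n -[X in _ *: X]scaler_nat scalerA mulVf ?pnatr_eq0 // scale1r.
rewrite savg_partial savg_flip_in // eqxx opprK half.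
rewrite mulrSr scalerDl scale1r [_ + savg _ _ _ _]addrC -addrA; congr (_ + _).
have -> : (n - #|S|)%N = #|[pred i | i \notin S]|.
  by rewrite -[RHS](addKn #|S|) [(_ + #|_|)%N in RHS](cardC S) card_ord.
rewrite scaler_nat -sumr_const -sumrB; apply: eq_bigr => i iS.
have ji : j != i by apply: contraNneq iS => <-.
rewrite savg_partial savg_setU1 //.
set a := savg _ _ _ _; set b := savg _ _ _ _.
by rewrite -[X in _ = X - _]half -[RHS]scalerBr opprD addrACA subrr add0r.
Qed.

End SignedAverage.

(** * The weights and their total mass *)

Section Weights.
Context (R : realType) (n : nat).

(* [wt 0 = 0] since [0^-1 = 0]: the empty set carries no weight. *)
Definition wt (k : nat) : R := (k%:R * 'C(n, k)%:R)^-1.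

Lemma wt_ge0 k : 0 <= wt k.
Proof. by rewrite invr_ge0 mulr_ge0. Qed.

(** For k > 0 both sides are the inverse of 'C(n, k). At k = 0 the boolean term makes up for
    [wt 0 = 0]; it is the source of the one term that survives the telescoping. *)
Lemma wt_rec k : (k < n)%N ->
  (n - k)%:R * wt k.+1 = k%:R * wt k + (k == 0%N)%:R.
Proof.
move=> kn; rewrite /wt -natrM mul_bin_left natrM invfM mulrA.
rewrite mulfV ?mul1r ?pnatr_eq0 -?lt0n ?subn_gt0 //.
case: k kn => [|k] kn; first by rewrite mul0r add0r bin0 invr1.
by rewrite invfM mulrA mulfV ?pnatr_eq0 // mul1r addr0.
Qed.

(** The 'C(n, k) sets of size k cancel the binomial in their common weight. *)
Lemma sum_wt : \sum_(S : {set 'I_n}) wt #|S| = \sum_(1 <= k < n.+1) (k%:R : R)^-1.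
Proof.
have cardS (S : {set 'I_n}) : (#|S| < n.+1)%N by have := max_card S; rewrite card_ord ltnS.
rewrite (partition_big (fun S : {set 'I_n} => Ordinal (cardS S)) predT) //=.
rewrite big_add1 /= big_ord_recl big1 ?add0r => [|S /eqP/(congr1 val) /= ->]; last first.
  by rewrite /wt mul0r invr0.
rewrite big_mkord; apply: eq_bigr => k _.
rewrite (eq_bigr (fun=> wt k.+1)) => [|S /eqP/(congr1 val) /= -> //].
rewrite sumr_const (eq_card (B := [set S : {set 'I_n} | #|S| == k.+1]%SET)); last first.
  by move=> S; rewrite !inE.
rewrite card_draws card_ord /wt -[LHS]mulr_natl invfM mulrCA mulfV ?mulr1 //.
by rewrite pnatr_eq0 -lt0n bin_gt0.
Qed.

End Weights.

(** * Telescoping over subsets *)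

Lemma sum_wt_savg (R : realType) (X : normedModType R) n (f : cube n -> X) (j : 'I_n) e :
  \sum_(S : {set 'I_n}) wt R n #|S| *: savg S j (laplacian f) e = partial j f e.
Proof.
rewrite (bigID (fun S : {set 'I_n} => j \in S)) /= [X in _ + X]big1 ?addr0; last first.
  by move=> S jS; rewrite savg_notin ?scaler0.
under eq_bigr => S jS do
  rewrite savg_laplacian // scalerBr scalerA scaler_sumr.
rewrite sumrB.
(* A set T containing [j] arises as [i |: S] once for each of the |T| - 1 elements [i] of T other
   than [j]. *)
have -> : \sum_(S : {set 'I_n} | j \in S) \sum_(i | i \notin S)
      wt R n #|S| *: savg (i |: S) j f e =
    \sum_(S : {set 'I_n} | j \in S) (#|S|.-1%:R * wt R n #|S|.-1) *: savg S j f e.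
  transitivity (\sum_(S : {set 'I_n} | j \in S) \sum_(i | (i \in S) && (i != j))
      wt R n #|S|.-1 *: savg S j f e); last first.
    apply: eq_bigr => S jS; rewrite -scaler_suml; congr (_ *: _).
    have -> : #|S|.-1 = #|S :\ j| by rewrite (cardsD1 j S) jS.
    rewrite mulr_natl -sumr_const; apply: eq_bigl => i.
    by rewrite !inE andbC.
  rewrite [LHS](exchange_big_dep predT) //= [RHS](exchange_big_dep predT) //=.
  apply: eq_bigr => i _.
  rewrite [RHS](reindex_onto (fun S => i |: S) (fun S => S :\ i)) /=; last first.
    by move=> S /and3P[_ iS _]; rewrite finset.setD1K.
  apply: eq_big => [S|S /andP[_ iS]]; last by rewrite cardsU1 iS.
  rewrite !inE eqxx /=; have [iS|iS] := boolP (i \in S).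
    rewrite andbF; apply/esym/negbTE; rewrite negb_and; apply/orP; right.
    by apply: contraL iS => /eqP <-; rewrite !inE eqxx.
  rewrite finset.setU1K // eqxx !andbT eq_sym; case: eqP => [<-|]; last by rewrite andbT.
  by rewrite (negbTE iS).
(* By [wt_rec] at |S| - 1, the coefficient is 1 for the singleton of [j] and 0 for every larger
   set. *)
rewrite -sumrB (bigD1 [set j]%SET) ?inE //= big1 ?addr0 => [|S /andP[jS Sj]].
  rewrite cards1 mul0r scale0r subr0 savg_set1.
  have n0 : (0 < n)%N := leq_ltn_trans (leq0n j) (ltn_ord j).
  by rewrite subn1 prednK // mulrC -{1}(subn0 n) wt_rec // mul0r add0r scale1r.
rewrite -scalerBl; have [k Sk] : exists k, #|S| = k.+2.
  have : [set j]%SET \proper S by rewrite finset.properEneq eq_sym Sj finset.sub1set.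
  by move/proper_card; rewrite cards1; case: #|S| => [|[|k]] // _; exists k.
have kn : (k.+1 < n)%N by have := max_card S; rewrite card_ord Sk.
rewrite Sk /= subnSK // mulrC wt_rec // addr0 subrr scale0r //.
Qed.

(** * Jensen's inequality for powers, with weights of arbitrary total mass *)

Lemma powR_sum_le (R : realType) (I : finType) (w x : I -> R) (r : R) :
  1 <= r -> (forall i, 0 <= w i) -> (forall i, 0 <= x i) ->
  (\sum_i w i * x i) `^ r <=
  (\sum_i w i) `^ (r - 1) * \sum_i w i * x i `^ r.
Proof.
move=> r1 w0 x0; have r0 : 0 < r by exact: lt_le_trans r1.
set W := \sum_i w i; have W0 : 0 <= W by exact: sumr_ge0.
(* The conjugate exponent [q] below is finite only for r > 1. *)
have [->|r_neq1] := eqVneq r 1.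
  rewrite subrr powRr0 mul1r powRr1; last by apply: sumr_ge0 => i _; exact: mulr_ge0.
  by apply: ler_sum => i _; rewrite powRr1.
have {r_neq1}r_gt1 : 1 < r by rewrite lt_neqAle eq_sym r_neq1.
set M := \sum_i w i * x i; have M0 : 0 <= M by apply: sumr_ge0 => i _; exact: mulr_ge0.
have [WE|WN0] := eqVneq W 0.
  have wE i : w i = 0.
    by move/eqP: WE; rewrite psumr_eq0 // => /allP/(_ i (mem_index_enum i))/eqP.
  rewrite /M big1 => [|i _]; last by rewrite wE mul0r.
  by rewrite powR0 ?gt_eqF // big1 ?mulr0 // => i _; rewrite wE mul0r.
pose b := M / W; have b0 : 0 <= b by exact: divr_ge0.
have Mb : M = W * b by rewrite /b mulrC divfK.
pose q := r / (r - 1); have rB0 : 0 < r - 1 by rewrite subr_gt0.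
have q0 : 0 < q by exact: divr_gt0.
(* Young's inequality, i.e. the tangent of [x `^ r] at the mean [b]. *)
have young i : x i * b `^ (r - 1) <= x i `^ r / r + b `^ r / q.
  have -> : b `^ r = (b `^ (r - 1)) `^ q.
    by rewrite -powRrM /q mulrC divfK ?gt_eqF.
  apply: conjugate_powR => //; first exact: powR_ge0.
  by rewrite /q; field; rewrite gt_eqF //= gt_eqF.
(* Average Young's inequality with the weights. The left side is W b^r, and 1 - 1/q = 1/r turns the
   result into [le2]. *)
have : M * b `^ (r - 1) <= (\sum_i w i * x i `^ r) / r + W * b `^ r / q.
  rewrite /M mulr_suml mulr_suml /W !mulr_suml -big_split /=.
  by apply: ler_sum => i _; rewrite -!mulrA -mulrDr ler_wpM2l.
rewrite {1}Mb -mulrA mulr_powRB1 // => le1.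
have le2 : W * b `^ r <= \sum_i w i * x i `^ r.
  have : W * b `^ r / r <= (\sum_i w i * x i `^ r) / r.
    have -> : W * b `^ r / r = W * b `^ r - W * b `^ r / q.
      by rewrite /q; field; rewrite !gt_eqF.
    by rewrite lerBlDr.
  by rewrite ler_pM2r // invr_gt0.
by rewrite Mb powRM // -(mulr_powRB1 W0 r0) [W * _]mulrC -mulrA ler_wpM2l ?powR_ge0.
Qed.

(** * Norm estimates and the bound on the constant *)

Lemma mean_ge0 (R : realType) n (g : cube n -> R) : (forall e, 0 <= g e) -> 0 <= mean g.
Proof. by move=> g0; rewrite mulr_ge0 ?invr_ge0 ?exprn_ge0 ?sumr_ge0. Qed.

Lemma pisier_ineq_harmonic (R : realType) (X : normedModType R) (p : \bar R)
    (n : nat) (hp : (1%:E <= p)%E) :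
  pisier_ineq X p n (\sum_(1 <= k < n.+1) (k%:R : R)^-1).
Proof.
move=> f; set H := \sum_(1 <= k < n.+1) _.
set G := fun e => \sum_(j < n) partial j (f j) e.
set F := fun e d => \sum_(j < n) signc R d j *: laplacian (f j) e.
(* Indexing by pairs (S, d) makes [G e] a single nonnegative combination of total mass [H]. *)
pose I := ({set 'I_n} * cube n)%type.
pose w (s : I) : R := wt R n #|s.1| * (2 ^+ n)^-1.
have w0 s : 0 <= w s by rewrite mulr_ge0 ?wt_ge0 // invr_ge0 exprn_ge0.
have two0 : (2 : R) ^+ n != 0 by rewrite expf_neq0 ?pnatr_eq0.
have sumw : \sum_s w s = H.
  rewrite -(pair_bigA _ (fun (S : {set 'I_n}) (d : cube n) => wt R n #|S| * (2 ^+ n)^-1)) /=.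
  rewrite /H -sum_wt; apply: eq_bigr => S _; rewrite sumr_const.
  by rewrite card_ffun card_bool card_ord -[LHS]mulr_natr natrX mulfVK.
have H0 : 0 <= H by rewrite -sumw sumr_ge0.
have GE e : G e = \sum_(s : I) w s *: F (twist s.1 s.2 e) s.2.
  rewrite -(pair_bigA _ (fun (S : {set 'I_n}) (d : cube n) =>
    (wt R n #|S| * (2 ^+ n)^-1) *: F (twist S d e) d)) /=.
  rewrite [LHS](eq_bigr _ (fun j _ => esym (sum_wt_savg (f j) j e))).
  rewrite exchange_big /=; apply: eq_bigr => S _.
  rewrite -[LHS]scaler_sumr -[RHS]scaler_sumr -[RHS]scalerA; congr (_ *: _).
  rewrite -[LHS]scaler_sumr; congr (_ *: _).
  by rewrite exchange_big.
have normG e : `|G e| <= \sum_(s : I) w s * `|F (twist s.1 s.2 e) s.2|.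
  rewrite GE; apply: le_trans (ler_norm_sum _ _ _) _.
  by apply: ler_sum => s _; rewrite normrZ ger0_norm.
case: p hp => [r| |//]; rewrite ?lee_fin => hr /=.
- have r0 : 0 < r := lt_le_trans ltr01 hr.
  set N := mean (fun d => mean (fun e => `|F e d| `^ r)).
  have N0 : 0 <= N by apply: mean_ge0 => d; apply: mean_ge0 => e; exact: powR_ge0.
  suff le : mean (fun e => `|G e| `^ r) <= H `^ r * N.
    have -> : H * N `^ r^-1 = (H `^ r * N) `^ r^-1.
      by rewrite powRM ?powR_ge0 // -powRrM mulfV ?gt_eqF // powRr1.
    rewrite ge0_ler_powR ?nnegrE ?invr_ge0 ?(ltW r0) //.
      by apply: mean_ge0 => e; exact: powR_ge0.
    by rewrite mulr_ge0 ?powR_ge0.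
  have {}normG e : `|G e| `^ r <=
      H `^ (r - 1) * \sum_(s : I) w s * `|F (twist s.1 s.2 e) s.2| `^ r.
    rewrite -sumw; apply: le_trans (powR_sum_le hr w0 _) => [|s]; last exact: normr_ge0.
    rewrite ge0_ler_powR ?nnegrE ?(ltW r0) ?normr_ge0 ?normG //.
    by apply: sumr_ge0 => s _; rewrite mulr_ge0.
  apply: (@le_trans _ _ ((2 ^+ n)^-1 * \sum_(e : cube n)
      H `^ (r - 1) * \sum_(s : I) w s * `|F (twist s.1 s.2 e) s.2| `^ r)).
    by rewrite ler_wpM2l ?invr_ge0 ?exprn_ge0 //; apply: ler_sum => e _.
  (* Of the factor H^r, Jensen supplies H^(r - 1); the last [H] comes from summing the weights over
     [S]. *)
  rewrite -mulr_sumr mulrCA -(mulr_powRB1 H0 r0) [H * _]mulrC -mulrA.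
  rewrite ler_wpM2l ?powR_ge0 // exchange_big /=.
  (* For fixed (S, d) the twist permutes the cube, hence drops out of the sum over [e]. *)
  have twist_sum (s : I) : \sum_(e : cube n) w s * `|F (twist s.1 s.2 e) s.2| `^ r =
      w s * \sum_(e : cube n) `|F e s.2| `^ r.
    by rewrite -mulr_sumr [in RHS](reindex_inj (inv_inj (twistK s.1 s.2))).
  rewrite (eq_bigr _ (fun s _ => twist_sum s)).
  rewrite -(pair_bigA _ (fun (S : {set 'I_n}) (d : cube n) =>
    wt R n #|S| * (2 ^+ n)^-1 * \sum_(e : cube n) `|F e d| `^ r)) /=.
  rewrite /H -sum_wt mulr_suml mulr_sumr ler_sum // => S _.
  rewrite /N /mean !mulr_sumr ler_sum // => d _.
  by rewrite -mulrA mulrCA.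
- set N := \big[Num.max/0]_(d : cube n) \big[Num.max/0]_(e : cube n) `|F e d|.
  have N0 : 0 <= N by exact: bigmax_ge_id.
  apply: bigmax_le => [|e _]; first exact: mulr_ge0.
  apply: le_trans (normG e) _; rewrite -sumw mulr_suml; apply: ler_sum => s _.
  rewrite ler_wpM2l //.
  apply: le_trans (le_bigmax 0 (fun d => \big[Num.max/0]_(e : cube n) `|F e d|) s.2).
  exact: (le_bigmax 0 (fun e => `|F e s.2|)).
Qed.

Theorem theorem1p3 (R : realType) (X : completeNormedModType R) (p : \bar R)
    (n : nat) (hp : (1%:E <= p)%E) :
  (pisier_constant X p n <= (\sum_(1 <= k < n.+1) (k%:R : R)^-1)%:E)%E.
Proof.
have ineqH := @pisier_ineq_harmonic R X p n hp.
set H := \sum_(1 <= k < n.+1) _ in ineqH *.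
have H0 : 0 <= H by apply: sumr_ge0 => k _; rewrite invr_ge0.
(* For [n = 0] the bound [H = 0] is not itself admissible in the infimum. *)
apply/lee_addgt0Pr => eps eps0; rewrite -EFinD; apply: ereal_inf_lbound.
exists (H + eps) => //; split; first by rewrite ltr_wpDl.
move=> f; apply: le_trans (ineqH f) _; rewrite ler_wpM2r ?lerDl ?(ltW eps0) //.
by case: p {hp ineqH} => [r| |] //=; [exact: powR_ge0 | exact: bigmax_ge_id].
Qed.
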